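(* Let $m_1,m_2$ be positive real numbers with $m_1\leq 1.8m_2$. Let $\beta=\max\{x\in[0.5,1) : \frac{2(1-x)(1+x)^2}{x(x+2)}\geq \frac{m_1}{m_2}\}$ and $r_0=\frac{2}{1-\beta}m_1$. Let $G\in\mathcal{G}_{m_1,m_2}$ and let $r$ be an integer with $r\geq r_0$. If $\Delta(G)\leq r$, then $G$ has an equitable $r$-coloring.
   Context: All graphs are finite and simple. For a graph $H$, $|H|$ denotes its number of vertices and $\lVert H\rVert$ its number of edges; $\Delta(G)$ is the maximum degree. For real numbers $m_1,m_2$, $\mathcal{G}_{m_1,m_2}$ is the class of graphs $G$ such that $\lVert H\rVert\leq m_1|H|$ for every subgraph $H$ of $G$, and $\lVert H\rVert\leq m_2|H|$ for every bipartite subgraph $H$ of $G$. An equitable $r$-coloring of a graph is a partition of its vertex set into $r$ independent sets $V_1,\dots,V_r$ (some possibly empty) with $\big||V_i|-|V_j|\big|\leq 1$ for all $i,j$. (Equivalently, $\beta$ is the unique root in $[0.5,1)$ of $2m_2(1-x)(1+x)^2-m_1x(2+x)$.) *)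

(* Defs.v *)
From HB Require Import structures.
From mathcomp Require Import all_boot all_order all_algebra.
From mathcomp Require Import reals.
Set Implicit Arguments. Unset Strict Implicit. Unset Printing Implicit Defensive.
Import Order.TTheory GRing.Theory Num.Theory.

Definition simple_graph (T : finType) (adj : rel T) : Prop :=
  symmetric adj /\ irreflexive adj.

Definition edges (T : finType) (adj : rel T) : {set {set T}} :=
  [set e : {set T} | [exists x, exists y, adj x y && (e == [set x; y])]].

Definition is_subgraph (T : finType) (adj : rel T) (V : {set T}) (E : {set {set T}}) : Prop :=
  E \subset edges adj /\ (forall e, e \in E -> e \subset V).

(* H = (V,E) is bipartite: V splits into A and V \ A with every edge crossing. *)
Definition is_bipartite (T : finType) (V : {set T}) (E : {set {set T}}) : Prop :=
  exists A : {set T}, A \subset V /\ (forall e, e \in E -> #|e :&: A| = 1%N).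

Definition in_class (R : realType) (m1 m2 : R) (T : finType) (adj : rel T) : Prop :=
  (forall V E, is_subgraph adj V E -> (#|E|%:R <= m1 * #|V|%:R)%R) /\
  (forall V E, is_subgraph adj V E -> is_bipartite V E ->
       (#|E|%:R <= m2 * #|V|%:R)%R).

Definition degree (T : finType) (adj : rel T) (x : T) : nat := #|[set y | adj x y]|.

(* Maximum degree Delta(G) (0 for the empty graph). *)
Definition max_degree (T : finType) (adj : rel T) : nat := \max_(x : T) degree adj x.

(* Equitable r-coloring: f assigns a class in 'I_r to each vertex; classes are
   independent and their sizes differ by at most one (classes may be empty). *)
Definition equitable_coloring (T : finType) (adj : rel T) (r : nat) (f : T -> 'I_r) : Prop :=
  (forall x y, adj x y -> f x != f y) /\
  (forall i j : 'I_r, (#|[set x | f x == i]| <= #|[set x | f x == j]|.+1)%N).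

Definition has_equitable_coloring (T : finType) (adj : rel T) (r : nat) : Prop :=
  exists f : T -> 'I_r, equitable_coloring adj f.

Definition beta_pred (R : realType) (m1 m2 : R) (x : R) : Prop :=
  (2^-1 <= x)%R /\ (x < 1)%R /\
  (m1 / m2 <= (2 * (1 - x) * (1 + x) ^+ 2) / (x * (x + 2)))%R.

Definition is_beta (R : realType) (m1 m2 b : R) : Prop :=
  beta_pred m1 m2 b /\ (forall x, beta_pred m1 m2 x -> (x <= b)%R).

(* Main.v *)
Require Import Defs.
From HB Require Import structures.
From mathcomp Require Import all_boot all_order all_algebra.
From mathcomp Require Import reals.
From mathcomp Require Import zify lra.
Set Implicit Arguments.
Unset Strict Implicit.
Unset Printing Implicit Defensive.
Import Order.TTheory GRing.Theory Num.Theory.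

(** Insert a vertex [x] of minimum degree, at most [2 m1 <= (1 - beta) r], into a
    balanced colouring of the rest.  Draw an arrow from class [i] to class [j] when
    some vertex of [i] has no neighbour in [j]; shifting vertices along a path of
    arrows moves a surplus, so [x] can be inserted unless none of the at least
    [beta r] classes free for [x] reaches an undersized class.  Choose the
    colouring with the largest set [A] of classes reaching an undersized one.

    A set of [s] full classes that no arrow leaves sends at least one edge from each
    of its vertices to each of the [r - s] other classes, so the bipartite density
    bound gives [s (r - s) <= m2 r]: with [y = r / (1 + beta)], either
    [s <= beta y / 2] or [s >= (1 + beta / 2) y].  Together with the bound on the
    degree sum this produces a strongly connected set [C] of [s >= (1 + beta / 2) y]
    classes outside [A] that are reachable from [x].

    Let [W] in [A] be at maximum distance from the undersized classes.  Every vertex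
    coloured in [C] has a neighbour in [W], so some [w] in [W] has at least
    [2 s - r >= y] solo neighbours, those with [w] as only neighbour in [W].  If [w]
    could move to another class of [A], a solo neighbour would replace it and [x]
    could be inserted.  If [w] has no neighbour in some class of [C], two nonadjacent
    solo neighbours would allow enlarging [A]; otherwise at least [2 s - 2 r + q] of
    the [q] solo neighbours are alone in their class in the neighbourhood of [w], and
    a nonadjacent pair of one of these and a solo neighbour would allow enlarging
    [A].  So [w] and its solo neighbours span more than [m1 (q + 1)] edges. *)

(** * Terminal vertices of a digraph *)

Lemma shortest_path_function (I : finType) (e : rel I) (K : {set I}) :
  exists d : I -> nat, forall i,
    (exists2 k, k \in K & connect e i k) ->
    (exists p, [/\ path e i p, last i p \in K & size p = d i]) /\
    (forall p, path e i p -> last i p \in K -> d i <= size p).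
Proof.
suff: forall i, exists n : nat, (exists2 k, k \in K & connect e i k) ->
    (exists p, [/\ path e i p, last i p \in K & size p = n]) /\
    (forall p, path e i p -> last i p \in K -> n <= size p).
  by move=> /fin_all_exists.
move=> i.
case: (boolP [exists k in K, connect e i k]); last first.
  by move=> /exists_inPn nK; exists 0 => -[k kK]; rewrite (negPf (nK _ kK)).
case/exists_inP => k kK /connectP [p pp lp].
pose P n := [exists p : n.-tuple I, path e i p && (last i p \in K)].
have exP : exists n, P n.
  exists (size p); apply/existsP; exists (in_tuple p).
  by rewrite /= pp -lp kK.
case: (ex_minnP exP) => n /existsP [q /andP [pq lq]] minn; exists n => _; split.
  by exists q; rewrite size_tuple.
move=> q' pq' lq'; apply: minn; apply/existsP; exists (in_tuple q').
by rewrite /= pq' lq'.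
Qed.

(** Choose [w] at maximum distance from [K]. If a simple path cut out of a shortest path from [i]
    met [w], its tail from [w] would make the distance of [w] smaller than that of [i]; applying
    maximality to [i] gives a contradiction. *)
Lemma terminal_vertex (I : finType) (e : rel I) (K : {set I}) (i0 : I) :
  i0 \in K ->
  exists w, (exists2 k, k \in K & connect e w k) /\
    forall i, i != w -> (exists2 k, k \in K & connect e i k) ->
      exists p, [/\ path e i p, uniq (i :: p), last i p \in K & w \notin i :: p].
Proof.
move=> i0K.
have [d dP] := shortest_path_function e K.
pose Rch i := [exists k in K, connect e i k].
have Ri0 : Rch i0 by apply/exists_inP; exists i0.
case: (arg_maxnP d Ri0) => w /exists_inP Rw maxw; exists w; split => //.
move=> i iw Ri; have [[p [pp lp sp]] _] := dP _ Ri.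
case/shortenP: pp lp sp => p' pp' up' sub lp' sp.
exists p'; split => //.
apply/negP; rewrite in_cons eq_sym (negPf iw) /= => wp'.
case/splitPr: wp' pp' lp' up' sub => p1 p2 pp' lp' up' sub.
have [_ minw] := dP _ Rw.
have : d w <= size p2.
  move: pp'; rewrite cat_path /= => /and3P [_ _ pp2]; apply: minw => //.
  by move: lp'; rewrite last_cat.
have szp : size (p1 ++ w :: p2) <= size p.
  by apply: uniq_leq_size => //; case/andP: up'.
have /= := maxw i; rewrite /Rch.
have -> : [exists k in K, connect e i k] by apply/exists_inP.
move=> /(_ isT); rewrite size_cat /= in szp; lia.
Qed.

Lemma path_connect_last (I : finType) (e : rel I) (i l : I) (p : seq I) :
  path e i p -> l \in i :: p -> connect e l (last i p).
Proof.
move=> pp /splitPl lp; case: lp pp => p1 p2 <-.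
rewrite cat_path last_cat => /andP [_ pp2].
by apply/connectP; exists p2.
Qed.

(** * Recolouring along paths of colour classes *)

Section Recolouring.

Variables (T : finType) (adj : rel T) (r : nat).
Hypotheses (adj_sym : symmetric adj) (adj_irr : irreflexive adj).
Implicit Types (f g : T -> 'I_r) (V : {set T}).

Definition proper_on V f := {in V &, forall y z, adj y z -> f y != f z}.

Definition colour_class V f j := [set y in V | f y == j].

Definition free_for V f y j := [forall z in V, (f z == j) ==> ~~ adj y z].

Definition arrow V f : rel 'I_r :=
  fun i j => [exists y in V, (f y == i) && free_for V f y j].

Definition recolour f y k := fun u => if u == y then k else f u.

(** Every class has size [t] or [t - 1]. If all sizes are equal, the common size and its successor
    are both admissible values of [t]; no class is small for the first, every class is for the
    second. *)
Definition balanced V f t :=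
  forall j, #|colour_class V f j| <= t <= #|colour_class V f j|.+1.

Definition small V f t := [set j | #|colour_class V f j| < t].

Definition reaching V f t :=
  [set i | [exists k in small V f t, connect (arrow V f) i k]].

Lemma free_forP V f y j :
  reflect (forall z, z \in V -> f z = j -> ~~ adj y z) (free_for V f y j).
Proof.
apply: (iffP forall_inP) => [H z zV fz | H z zV].
  by have /implyP := H z zV; apply; apply/eqP.
by apply/implyP => /eqP; apply: H.
Qed.

Lemma free_forPn V f y j :
  reflect (exists z, [/\ z \in V, f z = j & adj y z]) (~~ free_for V f y j).
Proof.
apply: (iffP forall_inPn) => [[z zV] | [z [zV fz yz]]].
  by rewrite negb_imply negbK => /andP [/eqP fz yz]; exists z.
by exists z => //; rewrite negb_imply negbK fz eqxx.
Qed.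

Lemma arrowP V f i j :
  reflect (exists y, [/\ y \in V, f y = i & free_for V f y j]) (arrow V f i j).
Proof.
apply: (iffP exists_inP) => [[y yV /andP [/eqP fy fr]] | [y [yV fy fr]]].
  by exists y.
by exists y => //; rewrite fy eqxx.
Qed.

Lemma reachingP V f t i :
  reflect (exists2 k, k \in small V f t & connect (arrow V f) i k)
          (i \in reaching V f t).
Proof. by rewrite inE; exact: exists_inP. Qed.

Lemma reaching_connect V f t i j :
  connect (arrow V f) i j -> j \in reaching V f t -> i \in reaching V f t.
Proof.
move=> ij /reachingP [k ks jk]; apply/reachingP; exists k => //.
exact: connect_trans ij jk.
Qed.

Lemma not_reaching_adj V f t y i :
  y \in V -> f y \notin reaching V f t -> i \in reaching V f t ->
  exists z, [/\ z \in V, f z = i & adj y z].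
Proof.
move=> yV fy iA; apply/free_forPn/negP => fr; move/negP: fy; apply.
by apply: reaching_connect iA; apply/connect1/arrowP; exists y.
Qed.

Lemma proper_recolour V f y k :
  proper_on (V :\ y) f -> free_for (V :\ y) f y k -> proper_on V (recolour f y k).
Proof.
move=> prf /free_forP fr u v uV vV uv; rewrite /recolour.
case: (eqVneq u y) uv => [-> | uy] uv; case: (eqVneq v y) uv => [-> | vy] uv.
- by rewrite adj_irr in uv.
- apply/eqP => kv; have := fr v; rewrite !inE vy vV -kv uv => /(_ isT erefl).
  by [].
- apply/eqP => kv; have := fr u; rewrite !inE uy uV kv adj_sym uv.
  by move=> /(_ isT erefl).
- by apply: prf => //; rewrite !inE ?uy ?vy.
Qed.

Lemma proper_onS V V' f : V' \subset V -> proper_on V f -> proper_on V' f.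
Proof. by move=> /subsetP sub prf u v /sub uV /sub vV; apply: prf. Qed.

Lemma eq_colour_class V f g l :
  {in V, f =1 g} -> colour_class V f l = colour_class V g l.
Proof.
move=> fg; apply/setP => u; rewrite !inE.
by case: (boolP (u \in V)) => // /fg ->.
Qed.

Lemma card_colour_classD1 V f y l : y \in V ->
  #|colour_class V f l| = (l == f y) + #|colour_class (V :\ y) f l|.
Proof.
move=> yV; rewrite (cardsD1 y) inE yV /= eq_sym; congr (_ + #|pred_of_set _|).
by apply/setP => u; rewrite !inE andbA.
Qed.

Lemma card_class_recolour V f y k l : y \in V ->
  #|colour_class V (recolour f y k) l| + (l == f y) =
  #|colour_class V f l| + (l == k).
Proof.
move=> yV; rewrite !(card_colour_classD1 _ _ yV) /recolour eqxx.
rewrite (@eq_colour_class _ (recolour f y k) f); first by lia.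
by move=> u; rewrite !inE /recolour => /andP [/negPf ->].
Qed.

(** The witness of an arrow survives a recolouring in which the target class gains no vertex and the
    source class loses none. *)
Lemma arrow_transfer V f g i j :
  (forall u, u \in V -> g u = j -> f u = j) ->
  (forall u, u \in V -> f u = i -> g u = i) ->
  arrow V f i j -> arrow V g i j.
Proof.
move=> tgt src /arrowP [y [yV fy /free_forP fr]]; apply/arrowP; exists y.
split=> //; first exact: src.
by apply/free_forP => z zV gz; apply: fr => //; apply: tgt.
Qed.

Lemma path_transfer V f g i p :
  (forall u, u \in V -> g u \in p -> f u = g u) ->
  (forall u, u \in V -> f u \in belast i p -> g u = f u) ->
  path (arrow V f) i p -> path (arrow V g) i p.
Proof.
elim: p i => //= k p IHp i tgt src /andP [ik kp]; apply/andP; split.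
  apply: arrow_transfer ik => u uV uk.
    by rewrite tgt ?uk ?mem_head.
  by rewrite src ?uk ?mem_head.
apply: IHp kp => u uV up; first by apply: tgt => //; rewrite in_cons up orbT.
by apply: src => //; rewrite in_cons up orbT.
Qed.

(** Move the witness [y] of the first arrow from [i] to [k], then shift along the rest. The
    remaining arrows survive: [i] is not on the rest of the path, and [k], which gains [y], is a
    source but never a target there. That [i] gains no vertex keeps vertices free for [i] free. *)
Lemma shift_path V f i p :
  proper_on V f -> path (arrow V f) i p -> uniq (i :: p) ->
  exists g,
    [/\ proper_on V g,
        forall u, f u \notin belast i p -> g u = f u,
        forall u, g u = i -> f u = i,
        forall u, f u \in i :: p -> g u \in i :: p &
        forall l, #|colour_class V g l| + (l == i) =
                  #|colour_class V f l| + (l == last i p)].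
Proof.
elim: p i f => [|k p IHp] i f prf.
  by exists f; split.
rewrite [path _ _ _]/= => /andP [/arrowP [y [yV fy fr]] kp].
rewrite [uniq _]/= -/(uniq (k :: p)) => /andP [inkp ukp].
pose f1 := recolour f y k.
have f1y : f1 y = k by rewrite /f1 /recolour eqxx.
have f1N u : u != y -> f1 u = f u by rewrite /f1 /recolour => /negPf ->.
have prf1 : proper_on V f1.
  apply: proper_recolour; first exact: proper_onS (subsetDl _ _) prf.
  apply/free_forP => z; rewrite inE => /andP [_ zV].
  by have /free_forP := fr; apply.
have kNp : k \notin p by case/andP: ukp.
have kp1 : path (arrow V f1) k p.
  apply: path_transfer kp => u uV up.
    rewrite f1N //; apply: contraTN up => /eqP ->.
    by rewrite f1y.
  rewrite f1N //; apply: contraTN up => /eqP ->; rewrite fy.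
  by apply: contraNN inkp => /mem_belast.
have [g [prg gN gi gin gsz]] := IHp _ _ prf1 kp1 ukp.
have gE u : f1 u \notin k :: p -> g u = f1 u.
  by move=> up; apply: gN; apply: contraNN up => /mem_belast.
exists g; split => //.
- move=> u; rewrite in_cons negb_or => /andP [ui up].
  have uy : u != y by apply: contraNneq ui => ->; rewrite fy.
  by rewrite -(f1N _ uy) gN // f1N.
- move=> u gu.
  have up : f1 u \notin k :: p by apply: contraNN inkp => /gin; rewrite gu.
  have f1u : f1 u = i by rewrite -gE.
  case: (eqVneq u y) f1u => [-> | uy]; last by rewrite f1N.
  by rewrite fy.
- move=> u fu; case: (eqVneq u y) => [-> | uy].
    by rewrite in_cons gin ?orbT // f1y mem_head.
  move: fu; rewrite in_cons -(f1N _ uy) => /orP [/eqP fu | fu].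
    by rewrite gE fu ?mem_head.
  by rewrite in_cons gin ?orbT.
- move=> l; have /= := gsz l.
  have := card_class_recolour f k l yV; rewrite -/f1 fy => e1 e2.
  by apply: (@addIn (l == k)); rewrite addnAC e2 addnAC e1 addnAC.
Qed.

(** * Moves that finish the colouring or enlarge the reaching set *)

Definition extends_balanced V x t :=
  exists g, proper_on (x |: V) g /\ balanced (x |: V) g t.

(** A shift from [j] to [k] only removes from class [j], so [x] may still enter it. The net effect
    is one more vertex in class [k], which the size hypothesis permits. *)
Lemma insert_vertex V f x t j k :
  x \notin V -> proper_on V f -> free_for V f x j -> connect (arrow V f) j k ->
  (forall l, #|colour_class V f l| + (l == k) <= t <=
             (#|colour_class V f l| + (l == k)).+1) ->
  extends_balanced V x t.
Proof.
move=> xV prf fr /connectP [p0 pp0 ->] {k}.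
case/shortenP: pp0 => p pp up _ sz.
have [g [prg _ gj _ gsz]] := shift_path prf pp up.
have VE : (x |: V) :\ x = V.
  by apply/setP => u; rewrite !inE; case: eqVneq => // ->; rewrite (negPf xV).
have xxV : x \in x |: V by rewrite setU11.
exists (recolour g x j); split.
  apply: proper_recolour; rewrite VE //.
  apply/free_forP => z zV /gj fz.
  by have /free_forP := fr; apply.
move=> l; have := sz l; have := gsz l.
rewrite (card_colour_classD1 _ _ xxV) VE.
rewrite (@eq_colour_class _ (recolour g x j) g); last first.
  move=> u uV; rewrite /recolour; case: eqVneq => // ux.
  by rewrite -ux uV in xV.
have -> : recolour g x j x = j by rewrite /recolour eqxx.
by rewrite [(l == j) + _]addnC => ->.
Qed.

Lemma balanced_fill V f t k l : balanced V f t -> k \in small V f t ->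
  #|colour_class V f l| + (l == k) <= t <= (#|colour_class V f l| + (l == k)).+1.
Proof.
by move=> /(_ l) bal; rewrite inE; case: eqVneq bal => [-> | _]; lia.
Qed.

Lemma insert_reaching V f x t j :
  x \notin V -> proper_on V f -> balanced V f t ->
  free_for V f x j -> j \in reaching V f t -> extends_balanced V x t.
Proof.
move=> xV prf bal fr /reachingP [k ks jk].
by apply: (insert_vertex xV prf fr jk) => l; apply: balanced_fill.
Qed.

Definition solo V f w z :=
  adj z w && [forall u in V, ((f u == f w) && adj z u) ==> (u == w)].

Lemma soloP V f w z :
  reflect (adj z w /\ forall u, u \in V -> f u = f w -> adj z u -> u = w)
          (solo V f w z).
Proof.
apply: (iffP andP) => -[zw H]; split=> //.
  move=> u uV fu zu; apply/eqP; move/forall_inP: H => /(_ u uV) /implyP; apply.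
  by rewrite fu eqxx.
by apply/forall_inP => u uV; apply/implyP => /andP [/eqP fu zu]; apply/eqP/H.
Qed.

(* [w] leaves its class for [K], from where a shift fills a small class; [z]
   replaces [w], and [x] fills the class of [z]. *)
Lemma insert_movable V f x t j w z K p :
  x \notin V -> proper_on V f -> balanced V f t ->
  free_for V f x j -> connect (arrow V f) j (f z) -> j \notin reaching V f t ->
  w \in V -> z \in V -> f w \in reaching V f t ->
  solo V f w z -> free_for V f w K ->
  path (arrow V f) K p -> uniq (K :: p) -> last K p \in small V f t ->
  f w \notin K :: p -> extends_balanced V x t.
Proof.
move=> xV prf bal fr /connectP [q0 qq0 lz0] jA wV zV wA /soloP [zw zsolo] wK pp up.
move=> ls wp; case/shortenP: qq0 lz0 => q qq uq _ lz.
have pA l : l \in K :: p -> l \in reaching V f t.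
  by move=> lp; apply/reachingP; exists (last K p) => //; apply: path_connect_last lp.
have qA l : l \in j :: q -> l \notin reaching V f t.
  move=> /(path_connect qq) jl; apply: contraNN jA; exact: reaching_connect.
have zA : f z \notin reaching V f t by rewrite lz; apply/qA/mem_last.
have [g [prg gN gK gin gsz]] := shift_path prf pp up.
have gE u : f u \notin K :: p -> g u = f u.
  by move=> fu; apply: gN; apply: contraNN fu => /mem_belast.
have gE' u : g u \notin K :: p -> f u = g u.
  by move=> gu; rewrite gE //; apply: contraNN gu => /gin.
have zwN : z != w by apply: contraNneq zA => ->.
have gw : g w = f w by apply: gE.
have zp : f z \notin K :: p by apply: contraNN zA => /pA.
have gz : g z = f z by apply: gE.
pose g1 := recolour g w K; pose g2 := recolour g1 z (f w).
have g2z : g2 z = f w by rewrite /g2 /recolour eqxx.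
have g1w : g1 w = K by rewrite /g1 /recolour eqxx.
have g2w : g2 w = K by rewrite /g2 /recolour eq_sym (negPf zwN).
have g2N u : u != z -> u != w -> g2 u = g u.
  by rewrite /g2 /g1 /recolour => /negPf -> /negPf ->.
have KA : K \in reaching V f t by apply/pA/mem_head.
have prg2 : proper_on V g2.
  apply: proper_recolour.
    apply: proper_recolour.
      by apply: proper_onS prg; exact: subset_trans (subsetDl _ _) (subsetDl _ _).
    apply/free_forP => u; rewrite !inE => /and3P [_ _ uV] /gK fu.
    by move/free_forP: wK; apply.
  apply/free_forP => u; rewrite !inE => /andP [uz uV].
  rewrite /g1 /recolour; case: eqVneq => [_ Kw | uw gu].
    by rewrite -Kw mem_head in wp.
  apply/negP => zu; move/negP: uw; apply; apply/eqP/zsolo => //.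
  by rewrite gE' ?gu.
have sz2 l : #|colour_class V g2 l| + (l == f z) =
             #|colour_class V f l| + (l == last K p).
  have := gsz l; have := card_class_recolour g K l wV.
  have := card_class_recolour g1 (f w) l zV.
  rewrite -/g2 -/g1 gw.
  have -> : g1 z = f z by rewrite /g1 /recolour (negPf zwN).
  by move=> e1 e2 e3; exact: etrans e1 (etrans e2 e3).
apply: (insert_vertex xV prg2 (j := j) (k := f z)).
- apply/free_forP => u uV g2u.
  have uz : u != z by apply: contraNneq jA => uz; rewrite -g2u uz g2z.
  have uw : u != w by apply: contraNneq jA => uw; rewrite -g2u uw g2w.
  rewrite g2N // in g2u; move/free_forP: fr; apply => //.
  by rewrite gE' g2u //; apply: contraNN jA => /pA.
(* The first shift and the replacement of [w] stay within reaching classes, apart from the removal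
   of [z]. The path [q] avoids those classes, and [z] is taken from its last class, which is no
   source, so all its arrows survive. *)
- apply/connectP; exists q => //; apply: path_transfer qq => u uV.
    move=> g2u; have uA : g2 u \notin reaching V f t by apply: qA; rewrite in_cons g2u orbT.
    have uz : u != z by apply: contraNneq uA => uz; rewrite uz g2z.
    have uw : u != w by apply: contraNneq uA => uw; rewrite uw g2w.
    by rewrite g2N // in uA *; apply: gE'; apply: contraNN uA => /pA.
  move=> fu; have uA : f u \notin reaching V f t by apply/qA/mem_belast.
  have uz : u != z.
    apply: contraTneq fu => ->; rewrite lz.
    by move: uq; rewrite lastI rcons_uniq => /andP [].
  have uw : u != w by apply: contraNneq uA => uw; rewrite uw.
  by rewrite g2N //; apply: gE; apply: contraNN uA => /pA.
- by move=> l; rewrite sz2; apply: balanced_fill.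
Qed.

Definition terminal V f t W :=
  forall i, i != W -> i \in reaching V f t ->
  exists p, [/\ path (arrow V f) i p, uniq (i :: p), last i p \in small V f t &
                W \notin i :: p].

Definition immovable V f t w :=
  forall K, K \in reaching V f t -> K != f w -> ~~ free_for V f w K.

(** Common criterion for both enlarging moves: among the reaching classes only [f w] changes,
    trading [w] for [z]. Terminality gives every other reaching class a surviving path that avoids
    [f w]. If [f w] is not small, its first arrow is not witnessed by [w], which is immovable, so it
    survives too. Finally [z'] has lost its only neighbour in that class and is not adjacent to [z],
    so its class newly reaches. *)
Lemma reaching_enlarges V f g t w z z' :
  w \in V -> f w \in reaching V f t -> terminal V f t (f w) -> immovable V f t w ->
  (forall l, #|colour_class V g l| = #|colour_class V f l|) ->
  (forall u, u \in V -> f u \in reaching V f t -> f u != f w -> g u = f u) ->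
  (forall u, u \in V -> g u \in reaching V f t -> g u != f w -> f u = g u) ->
  (forall u, u \in V -> f u = f w -> u != w -> g u = f w) ->
  (forall u, u \in V -> g u = f w -> (f u = f w /\ u != w) \/ u = z) ->
  z' \in V -> g z' \notin reaching V f t -> solo V f w z' -> ~~ adj z' z ->
  #|reaching V f t| < #|reaching V g t|.
Proof.
move=> wV wA term imm sz fg gf fgw gfw zV zA /soloP [zw zsolo] zz.
have smE : small V g t = small V f t by apply/setP => l; rewrite !inE sz.
have subN i : i != f w -> i \in reaching V f t -> i \in reaching V g t.
  move=> iw iA; have [p [pp up lp wp]] := term _ iw iA.
  have pA l : l \in i :: p -> l \in reaching V f t.
    by move=> il; apply/reachingP; exists (last i p) => //; apply: path_connect_last il.
  have pw l : l \in i :: p -> l != f w by move=> il; apply: contraNneq wp => <-.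
  apply/reachingP; exists (last i p); first by rewrite smE.
  apply/connectP; exists p => //; apply: path_transfer pp => u uV.
    move=> gu; have up' : g u \in i :: p by rewrite in_cons gu orbT.
    by apply: gf => //; [apply: pA | apply: pw].
  move=> /mem_belast fu; apply: fg => //; [exact: pA | exact: pw].
have wAg : f w \in reaching V g t.
  case/reachingP: (wA) => k ks /connectP [p0 pp0 kE].
  case/shortenP: pp0 kE => -[|K p] pp up _ kE.
    by apply/reachingP; exists (f w) => //; rewrite smE -[f w]/(last (f w) [::]) -kE.
  case/andP: pp => /arrowP [v [vV fv fr]] pp.
  have KA : K \in reaching V f t.
    by apply/reachingP; exists k => //; apply/connectP; exists p.
  have Kw : K != f w.
    by case/andP: up => /= + _; apply: contraNneq => ->; rewrite mem_head.
  apply: reaching_connect (subN K Kw KA); apply/connect1/arrowP; exists v; split=> //.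
    by apply: fgw => //; apply: contraNneq (imm K KA Kw) => <-.
  apply/free_forP => u uV gu; move/free_forP: fr; apply => //.
  by rewrite -gu; apply: gf; rewrite ?gu.
apply: proper_card; apply/properP; split.
  apply/subsetP => i; case: (eqVneq i (f w)) => [-> _ | iw]; first exact: wAg.
  exact: subN iw.
exists (g z') => //; apply: reaching_connect wAg; apply/connect1/arrowP.
exists z'; split => //; apply/free_forP => u uV /(gfw _ uV) [[fu uw]|-> //].
by apply: contraNN uw => zu; apply/eqP/zsolo.
Qed.

(** Exchange the colours of [w] and [z]. Each is the only neighbour of the other in the class it
    enters, so the colouring stays proper and all sizes are kept. *)
Lemma swap_enlarges V f t w z z' :
  proper_on V f -> w \in V -> z \in V -> z' \in V ->
  f w \in reaching V f t -> terminal V f t (f w) -> immovable V f t w ->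
  f z \notin reaching V f t -> f z' \notin reaching V f t ->
  solo V f w z -> solo V f w z' -> z' != z -> ~~ adj z' z ->
  (forall u, u \in V -> f u = f z -> adj w u -> u = z) ->
  exists g, [/\ proper_on V g,
    forall l, #|colour_class V g l| = #|colour_class V f l| &
    #|reaching V f t| < #|reaching V g t|].
Proof.
move=> prf wV zV zV' wA term imm zA zA' sz sz' zzN zz single.
have zwN : z != w by apply: contraNneq zA => ->.
pose g1 := recolour f w (f z); pose g := recolour g1 z (f w).
have gz : g z = f w by rewrite /g /recolour eqxx.
have gw : g w = f z by rewrite /g /g1 /recolour eq_sym (negPf zwN) eqxx.
have gN u : u != z -> u != w -> g u = f u.
  by rewrite /g /g1 /recolour => /negPf -> /negPf ->.
have szg l : #|colour_class V g l| = #|colour_class V f l|.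
  have := card_class_recolour f (f z) l wV.
  have := card_class_recolour g1 (f w) l zV.
  rewrite -/g -/g1; have -> : g1 z = f z by rewrite /g1 /recolour (negPf zwN).
  by move=> e1 e2; exact: addIn (etrans e1 e2).
exists g; split => //.
  apply: proper_recolour.
    apply: proper_recolour.
      by apply: proper_onS prf; exact: subset_trans (subsetDl _ _) (subsetDl _ _).
    apply/free_forP => u; rewrite !inE => /and3P [_ uz uV] fu.
    by apply: contraNN uz => wu; apply/eqP/single.
  apply/free_forP => u; rewrite !inE => /andP [uz uV].
  rewrite /g1 /recolour; case: eqVneq => [_ zw | uw fu].
    by rewrite zw wA in zA.
  by case/soloP: sz => _ H; apply: contraNN uw => zu; apply/eqP/H.
apply: (@reaching_enlarges V f g t w z z') => //.
- move=> u uV uA uw; apply: gN; first by apply: contraNneq zA => <-.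
  by apply: contraNneq uw => ->.
- move=> u uV uA uw; rewrite gN //; first by apply: contraNneq uw => ->; rewrite gz.
  by apply: contraTneq uA => ->; rewrite gw.
- by move=> u uV fu uw; rewrite gN //; apply: contraNneq zA => <-; rewrite fu.
- move=> u uV gu; case: (eqVneq u z) => [-> | uz]; [by right | left].
  have uw : u != w by apply: contraNneq zA => uw; rewrite -gw -uw gu.
  by rewrite -gN.
- rewrite gN //; apply: contraNneq zA' => ->; exact: wA.
Qed.

(** Move [w] to [U] and [z] into the place of [w]; a shift from [U] to the old class of [z] then
    restores all sizes. The condition on [belast U p] ensures that the shift does not move [z']. *)
Lemma detour_enlarges_path V f t w z z' U p :
  proper_on V f -> w \in V -> z \in V -> z' \in V ->
  f w \in reaching V f t -> terminal V f t (f w) -> immovable V f t w ->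
  U \notin reaching V f t -> f z' \notin reaching V f t ->
  free_for V f w U ->
  path (arrow V f) U p -> uniq (U :: p) -> f z = last U p -> f z' \notin belast U p ->
  solo V f w z -> solo V f w z' -> z' != z -> ~~ adj z' z ->
  exists g, [/\ proper_on V g,
    forall l, #|colour_class V g l| = #|colour_class V f l| &
    #|reaching V f t| < #|reaching V g t|].
Proof.
move=> prf wV zV zV' wA term imm UA zA' fr pp up lz z'p sz sz' zzN zz.
have pA l : l \in U :: p -> l \notin reaching V f t.
  move=> /(path_connect pp) jl; apply: contraNN UA; exact: reaching_connect.
have zA : f z \notin reaching V f t by rewrite lz; apply/pA/mem_last.
have zwN : z != w by apply: contraNneq zA => ->.
pose g1 := recolour f w U; pose g2 := recolour g1 z (f w).
have g2z : g2 z = f w by rewrite /g2 /recolour eqxx.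
have g2w : g2 w = U by rewrite /g2 /g1 /recolour eq_sym (negPf zwN) eqxx.
have g2N u : u != z -> u != w -> g2 u = f u.
  by rewrite /g2 /g1 /recolour => /negPf -> /negPf ->.
have prg2 : proper_on V g2.
  apply: proper_recolour.
    apply: proper_recolour.
      by apply: proper_onS prf; exact: subset_trans (subsetDl _ _) (subsetDl _ _).
    apply/free_forP => u; rewrite !inE => /and3P [_ uz uV] fu.
    by move/free_forP: fr; apply.
  apply/free_forP => u; rewrite !inE => /andP [uz uV].
  rewrite /g1 /recolour; case: eqVneq => [_ zw | uw fu].
    by rewrite zw wA in UA.
  by case/soloP: sz => _ H; apply: contraNN uw => zu; apply/eqP/H.
have lNp : last U p \notin belast U p by move: up; rewrite lastI rcons_uniq => /andP [].
have pp2 : path (arrow V g2) U p.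
  apply: path_transfer pp => u uV up'.
    rewrite g2N //.
      apply: contraTneq up' => ->; rewrite g2z; apply: contraTN wA => wp.
      by apply: pA; rewrite in_cons wp orbT.
    by apply: contraTneq up' => ->; rewrite g2w; case/andP: up.
  rewrite g2N //; first by apply: contraTneq up' => ->; rewrite lz.
  by apply: contraTneq up' => ->; apply: contraTN wA => /mem_belast/pA.
have [g [prg gN _ gin gsz]] := shift_path prg2 pp2 up.
have gE u : g2 u \notin U :: p -> g u = g2 u.
  by move=> gu; apply: gN; apply: contraNN gu => /mem_belast.
have gE' u : g u \notin U :: p -> g2 u = g u.
  by move=> gu; rewrite gE //; apply: contraNN gu => /gin.
have szg l : #|colour_class V g l| = #|colour_class V f l|.
  have := card_class_recolour f U l wV.
  have := card_class_recolour g1 (f w) l zV.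
  have := gsz l; rewrite -/g2 -/g1 -lz.
  have -> : g1 z = f z by rewrite /g1 /recolour (negPf zwN).
  by move=> e1 e2 e3; exact: addIn (etrans e1 (etrans e2 e3)).
have Ap l : l \in reaching V f t -> l \notin U :: p by apply: contraTN => /pA.
have gw : g w \notin reaching V f t by apply/pA/gin; rewrite g2w mem_head.
have gz : g z = f w by rewrite gE g2z // Ap.
exists g; split => //.
apply: (@reaching_enlarges V f g t w z z') => //.
- move=> u uV uA uw.
  have g2u : g2 u = f u.
    apply: g2N; first by apply: contraNneq zA => <-.
    by apply: contraNneq uw => ->.
  by rewrite gE // g2u // Ap.
- move=> u uV uA uw; rewrite -gE' ?Ap // g2N //.
    by apply: contraNneq uw => ->; rewrite gz.
  by apply: contraNneq gw => <-.
- move=> u uV fu uw; have g2u : g2 u = f w.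
    by rewrite g2N //; apply: contraNneq zA => <-; rewrite fu.
  by rewrite gE g2u // Ap.
- move=> u uV gu; case: (eqVneq u z) => [-> | uz]; [by right | left].
  have uw : u != w by apply: contraNneq gw => <-; rewrite gu.
  by rewrite -g2N // gE' gu // Ap.
- have z'w : z' != w by apply: contraNneq zA' => ->.
  by rewrite gN g2N.
Qed.

Lemma detour_enlarges V f t w z z' U :
  proper_on V f -> w \in V -> z \in V -> z' \in V ->
  f w \in reaching V f t -> terminal V f t (f w) -> immovable V f t w ->
  U \notin reaching V f t -> free_for V f w U ->
  connect (arrow V f) U (f z) -> connect (arrow V f) U (f z') ->
  solo V f w z -> solo V f w z' -> z' != z -> ~~ adj z' z ->
  exists g, [/\ proper_on V g,
    forall l, #|colour_class V g l| = #|colour_class V f l| &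
    #|reaching V f t| < #|reaching V g t|].
Proof.
move=> prf wV zV zV' wA term imm UA fr Uz Uz' sz sz' zzN zz.
have zA : f z \notin reaching V f t by apply: contraNN UA; apply: reaching_connect.
have zA' : f z' \notin reaching V f t by apply: contraNN UA; apply: reaching_connect.
case/connectP: Uz => p0 pp0 lz; case/shortenP: pp0 lz => p pp up _ lz.
(* If the path meets the class of [z'] before its end, cut it there. The initial piece does not
   visit the class of [z] before its end, so [z] and [z'] can exchange roles. *)
case: (boolP (f z' \in belast U p)) => z'p; last first.
  exact: (detour_enlarges_path prf wV zV zV' wA term imm UA zA' fr pp up lz z'p).
have /splitPl : f z' \in U :: p by exact: mem_belast.
case E : _ / => [p1 p2 lp1].
have zp1 : f z \notin belast U p1.
  move: up z'p; rewrite lz E last_cat lp1; case: {E} p2 => [|k p2]; last first.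
    rewrite -cat_cons cat_uniq => /and3P [_ /hasPn H _] _.
    by apply: contraNN (H _ (mem_last k p2)) => /mem_belast.
  by rewrite cats0 -lp1 lastI rcons_uniq /= => /andP [].
apply: (@detour_enlarges_path V f t w z' z U p1) => //.
- by move: pp; rewrite E cat_path => /andP [].
- by move: up; rewrite E -cat_cons cat_uniq => /and3P [].
- by rewrite eq_sym.
- by rewrite adj_sym.
Qed.

End Recolouring.

(** * Counting edges between colour classes *)

Section EdgeCounts.

Variables (T : finType) (adj : rel T) (r : nat).
Hypotheses (adj_sym : symmetric adj) (adj_irr : irreflexive adj).
Implicit Types (f : T -> 'I_r) (V X Y : {set T}).

Definition nbrs X y := [set z in X | adj y z].

Lemma card_nbrsE X y : #|nbrs X y| = \sum_(z in X) adj y z.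
Proof.
by rewrite -sum1_card big_mkcond [RHS]big_mkcond; apply: eq_bigr => z _;
  rewrite inE; case: (z \in X) => //; case: adj.
Qed.

Lemma sum_nbrsC X Y :
  \sum_(y in X) #|nbrs Y y| = \sum_(z in Y) #|nbrs X z|.
Proof.
under eq_bigr do rewrite card_nbrsE; rewrite exchange_big /=.
by apply: eq_bigr => z _; rewrite card_nbrsE; apply: eq_bigr => y _; rewrite adj_sym.
Qed.

Lemma card_by_colour (D : {set T}) f (C : {set 'I_r}) :
  (forall z, z \in D -> f z \in C) ->
  #|D| = \sum_(l in C) #|[set z in D | f z == l]|.
Proof.
move=> DC; rewrite -sum1_card (partition_big f (mem C)) //.
by apply: eq_bigr => l _; rewrite -sum1_card; apply: eq_bigl => z; rewrite inE.
Qed.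

Lemma no_arrow_edges V f i l : ~~ arrow adj V f i l ->
  #|colour_class V f i| <=
  \sum_(u in colour_class V f i) #|nbrs (colour_class V f l) u|.
Proof.
move=> /arrowP nar; rewrite -sum1_card; apply: leq_sum => u.
rewrite inE => /andP [uV /eqP fu]; rewrite card_gt0; apply/set0Pn.
have /free_forPn [z [zV fz uz]] : ~~ free_for adj V f u l.
  by apply/negP => fr; apply: nar; exists u.
by exists z; rewrite !inE zV fz eqxx.
Qed.

Lemma card_not_free V f u : #|[set k | ~~ free_for adj V f u k]| <= #|nbrs V u|.
Proof.
apply: leq_trans (leq_imset_card f _); apply: subset_leq_card.
apply/subsetP => k; rewrite inE => /free_forPn [z [zV fz uz]].
by apply/imsetP; exists z; rewrite ?inE ?zV.
Qed.

(** The hypothesis asks for edges instead of missing arrows, so that a missing arrow in either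
    direction can supply it, provided its source class is full. *)
Lemma card_class_cut V f t (C : {set 'I_r}) :
  (forall i l, i \in C -> l \notin C ->
    t <= \sum_(u in colour_class V f i) #|nbrs (colour_class V f l) u|) ->
  #|C| * (r - #|C|) * t <=
  \sum_(u in [set u in V | f u \in C]) #|nbrs [set u in V | f u \notin C] u|.
Proof.
move=> H; rewrite (partition_big f (mem C)) /=; last by move=> u; rewrite inE => /andP [].
have -> : r - #|C| = #|~: C| by rewrite -[RHS](addKn #|C|) cardsC card_ord.
rewrite -mulnA -!sum_nat_const; apply: leq_sum => i iC.
have -> : \sum_(u in [set u in V | f u \in C] | f u == i)
     #|nbrs [set u in V | f u \notin C] u| =
  \sum_(l in ~: C) \sum_(u in colour_class V f i) #|nbrs (colour_class V f l) u|.
  rewrite exchange_big /=; apply: eq_big => [u | u _].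
    by rewrite !inE; case: eqVneq => [->|]; rewrite ?iC ?andbT ?andbF.
  rewrite (@card_by_colour _ f (~: C)); last first.
    by move=> z; rewrite !inE => /andP [/andP [_ ->]].
  apply: eq_bigr => l lC; apply: eq_card => z; rewrite !inE.
  rewrite inE in lC; case: (eqVneq (f z) l) => [->|]; rewrite ?andbF ?lC ?andbT //.
by apply: leq_sum => l; rewrite inE => /(H _ _ iC).
Qed.

Lemma card_balanced V f t :
  (forall j, #|colour_class V f j| <= t) -> #|V| <= r * t.
Proof.
move=> H; rewrite (@card_by_colour _ f [set: 'I_r]); last by move=> *; rewrite inE.
apply: (@leq_trans (\sum_(l in [set: 'I_r]) t)); first by apply: leq_sum => l _; apply: H.
by rewrite sum_nat_const cardsT card_ord.
Qed.

Lemma card_full_classes V f t (C : {set 'I_r}) :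
  (forall i, i \in C -> #|colour_class V f i| = t) ->
  #|[set u in V | f u \in C]| = #|C| * t.
Proof.
move=> H; rewrite (@card_by_colour _ f C); last by move=> z; rewrite inE => /andP [].
rewrite -sum_nat_const; apply: eq_bigr => i iC; rewrite -(H i iC).
by apply: eq_card => z; rewrite !inE; case: eqVneq => [->|]; rewrite ?iC ?andbF ?andbT.
Qed.

(* Each vertex of [S] distributes weight 2: all of it to its only neighbour in
   the class [W], or at least 1 to each of its neighbours there. *)
Lemma many_solo_neighbours V f t W (C : {set 'I_r}) :
  let S := [set z in V | f z \in C] in
  0 < t -> 0 < #|C| -> #|colour_class V f W| <= t ->
  (forall i, i \in C -> #|colour_class V f i| = t) ->
  (forall z, z \in S -> exists w, [/\ w \in V, f w = W & adj z w]) ->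
  exists w, [/\ w \in V, f w = W &
    2 * #|C| <= 2 * #|[set z in S | solo adj V f w z]| +
                #|[set z in S | adj w z & ~~ solo adj V f w z]|].
Proof.
move=> S t0 C0 Wt Ct nbW.
pose wt w := 2 * #|[set z in S | solo adj V f w z]| +
             #|[set z in S | adj w z & ~~ solo adj V f w z]|.
(* Averaging: [S] has [#|C| * t] vertices and class [W] at most [t], so some [w] receives weight at
   least [2 * #|C|]. *)
suff: 2 * #|S| <= \sum_(w in colour_class V f W) wt w.
  move=> H; case: (boolP [exists w in colour_class V f W, 2 * #|C| <= wt w]).
    case/exists_inP => w; rewrite inE => /andP [wV /eqP fw] Hw; by exists w.
  move/exists_inPn => Hn; move: H; rewrite (card_full_classes Ct).
  have : \sum_(w in colour_class V f W) wt w <= t * (2 * #|C|).-1.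
    apply: (@leq_trans (\sum_(w in colour_class V f W) (2 * #|C|).-1)).
      by apply: leq_sum => w /Hn; lia.
    by rewrite sum_nat_const leq_mul2r Wt orbT.
  nia.
have wtE w : wt w = \sum_(z in S) (2 * solo adj V f w z + (adj w z && ~~ solo adj V f w z)).
  rewrite big_split /= -big_distrr /= /wt; congr (2 * _ + _).
    by rewrite -sum1_card big_mkcond [RHS]big_mkcond; apply: eq_bigr => z _;
      rewrite inE; case: (z \in S) => //; case: solo.
  by rewrite -sum1_card big_mkcond [RHS]big_mkcond; apply: eq_bigr => z _;
    rewrite inE; case: (z \in S) => //; case: (_ && _).
rewrite (eq_bigr _ (fun w _ => wtE w)) exchange_big /= mulnC -sum_nat_const.
apply: leq_sum => z zS; have [w [wV fw zw]] := nbW z zS.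
have wW : w \in colour_class V f W by rewrite inE wV fw eqxx.
rewrite (bigD1 w) //=; case: (boolP (solo adj V f w z)) => [//|nsw].
have [u [uV fu zu uw]] : exists u, [/\ u \in V, f u = f w, adj z u & u != w].
  move: nsw; rewrite /solo zw /= => /forall_inPn [u uV].
  by rewrite negb_imply => /andP [/andP [/eqP fu zu] uw]; exists u.
have uW : u \in colour_class V f W by rewrite inE uV fu fw eqxx.
rewrite (bigD1 u) ?uW //= [adj w z]adj_sym zw /= [adj u z]adj_sym zu.
apply: (@leq_trans (1 + 1)) => //; apply: leq_add => //.
by apply: leq_trans (leq_addr _ _); case: solo.
Qed.

(** Each class of [C] contributes at least 2 to the right-hand side: a neighbour of [w] that is not
    solo counts 2, a solo one alone in its class among the neighbours of [w] counts 1 + 1, and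
    otherwise two neighbours count at least 1 each. *)
Lemma many_single_solo V f w (C : {set 'I_r}) :
  let S := [set z in V | f z \in C] in
  (forall i, i \in C -> ~~ free_for adj V f w i) ->
  2 * #|C| <= #|[set z in S | solo adj V f w z]| +
    2 * #|[set z in S | adj w z & ~~ solo adj V f w z]| +
    #|[set z in S | solo adj V f w z &
         [forall u in V, ((f u == f z) && adj w u) ==> (u == z)]]|.
Proof.
move=> S hit.
pose single z := [forall u in V, ((f u == f z) && adj w u) ==> (u == z)].
pose g z := solo adj V f w z + 2 * (adj w z && ~~ solo adj V f w z) +
            (solo adj V f w z && single z).
have -> : #|[set z in S | solo adj V f w z]| +
    2 * #|[set z in S | adj w z & ~~ solo adj V f w z]| +
    #|[set z in S | solo adj V f w z & single z]| = \sum_(z in S) g z.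
  rewrite /g 2!big_split /= -big_distrr /=; congr (_ + 2 * _ + _);
    by rewrite -sum1_card big_mkcond [RHS]big_mkcond; apply: eq_bigr => z _;
      rewrite inE; case: (z \in S) => //; case: (solo _ _ _ _ _) => //=;
      case: (_ && _) => //; case: single.
rewrite (partition_big f (mem C)) /=; last by move=> u; rewrite inE => /andP [].
rewrite mulnC -sum_nat_const; apply: leq_sum => i iC.
have /free_forPn [z [zV fz wz]] := hit i iC.
have zS : (z \in S) && (f z == i) by rewrite inE zV fz iC eqxx.
rewrite (bigD1 z) //=.
case: (boolP (solo adj V f w z)) => [zs | nzs]; last first.
  by rewrite /g wz (negPf nzs) /=; lia.
case: (boolP (single z)) => [sz | nsz]; first by rewrite /g zs sz /=; lia.
have [u [uV fu wu uz]] : exists u, [/\ u \in V, f u = f z, adj w u & u != z].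
  move: nsz => /forall_inPn [u uV].
  by rewrite negb_imply => /andP [/andP [/eqP fu zu] uw]; exists u.
have uS : [&& u \in S, f u == i & u != z] by rewrite inE uV fu fz iC eqxx.
have gz : 0 < g z by rewrite /g zs.
have gu : 0 < g u by rewrite /g wu; case: solo.
rewrite (bigD1 u) /= -?andbA //; apply: (@leq_trans (1 + 1)) => //.
exact: leq_add gz (leq_trans gu (leq_addr _ _)).
Qed.

(** Inside [w |: S], the vertex [w] has degree [#|S|], a vertex of [P] sees [w] and the rest of [S],
    and any other vertex of [S] sees [w] and all of [P]. *)
Lemma joined_degree_sum w (S P : {set T}) :
  P \subset S -> (forall z, z \in S -> adj w z) ->
  (forall z z', z \in P -> z' \in S -> z' != z -> adj z z') ->
  #|S| + #|P| * #|S| + (#|S| - #|P|) * #|P|.+1 <=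
  \sum_(u in w |: S) #|nbrs (w |: S) u|.
Proof.
move=> PS wS PSadj.
have wNS : w \notin S by apply/negP => /wS; rewrite adj_irr.
rewrite big_setU1 //= -addnA; apply: leq_add.
  by apply: subset_leq_card; apply/subsetP => z zS; rewrite !inE zS orbT wS.
rewrite (bigID (mem P)) /=; apply: leq_add.
  rewrite (eq_bigl (mem P)); last first.
    by move=> z /=; rewrite andbC; case: (boolP (z \in P)) => //= /(subsetP PS).
  rewrite -sum_nat_const; apply: leq_sum => z zP.
  have zS := subsetP PS z zP.
  have -> : #|S| = #|w |: (S :\ z)|.
    rewrite cardsU1 inE (negPf wNS) andbF [#|S|](cardsD1 z) zS; lia.
  apply: subset_leq_card; apply/subsetP => u; rewrite !inE => /orP [/eqP ->|].
    by rewrite eqxx adj_sym wS.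
  by case/andP => uz uS; rewrite uS orbT PSadj.
rewrite (eq_bigl (mem (S :\: P))); last by move=> u; rewrite /= inE andbC.
rewrite -cardsDS // -sum_nat_const.
apply: leq_sum => u; rewrite inE => /andP [uP uS].
have -> : #|P|.+1 = #|w |: P|.
  by rewrite cardsU1; case: (boolP (w \in P)) => // /(subsetP PS); rewrite (negPf wNS).
apply: subset_leq_card; apply/subsetP => v; rewrite !inE => /orP [/eqP ->|vP].
  by rewrite eqxx adj_sym wS.
rewrite (subsetP PS) // orbT adj_sym PSadj //.
by apply: contraNneq uP => ->.
Qed.

End EdgeCounts.

(** * The density argument *)

Section Density.

Variables (R : realFieldType) (T : finType) (adj : rel T) (r : nat) (b y : R).
Hypotheses (adj_sym : symmetric adj) (adj_irr : irreflexive adj).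
Implicit Types (f : T -> 'I_r) (V X Y : {set T}).

Local Open Scope ring_scope.

(* [y] stands for [r / (1 + b)]: this keeps all bounds below polynomial. *)
Hypotheses (b_gt0 : 0 < b) (b_lt1 : b < 1) (y_gt0 : 0 < y)
  (r_eq : r%:R = (1 + b) * y).
(** The two density bounds with [m1] and [m2] eliminated through [2 m1 <= (1 - b) r] and
    [4 (1 + b) m2 <= b (2 + b) y]. *)
Hypothesis sparse : forall X,
  (\sum_(u in X) #|nbrs adj X u|)%:R <= (1 - b) * (1 + b) * y * #|X|%:R.
Hypothesis sparse_cut : forall X Y, [disjoint X & Y] ->
  4 * (1 + b) * (\sum_(u in X) #|nbrs adj Y u|)%:R <=
  b * (2 + b) * y * (#|X| + #|Y|)%:R.
Hypothesis degree_le : forall X u, (#|nbrs adj X u| <= r)%N.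

(** Counting the edges across the cut and dividing by [t] gives
    [4 c ((1 + b) y - c) <= b (2 + b) y^2] for [c = #|C|]. The corresponding quadratic in [c] has
    roots [b y / 2] and [(1 + b / 2) y]. *)
Lemma cut_dichotomy V f t (C : {set 'I_r}) :
  (0 < t)%N -> (forall j, (#|colour_class V f j| <= t)%N) ->
  (forall i l, i \in C -> l \notin C ->
    (t <= \sum_(u in colour_class V f i) #|nbrs adj (colour_class V f l) u|)%N) ->
  #|C|%:R <= b / 2 * y \/ (1 + b / 2) * y <= #|C|%:R.
Proof.
have [[b0 b1] y0] := (b_gt0, b_lt1, y_gt0).
move=> t0 szt H.
set X := [set u in V | f u \in C]; set Y := [set u in V | f u \notin C].
have XY : [disjoint X & Y].
  by rewrite disjoints_subset; apply/subsetP => u; rewrite !inE => /andP [-> ->].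
have cXY : (#|X| + #|Y| <= r * t)%N.
  apply: leq_trans (card_balanced szt).
  rewrite -cardsUI (disjoint_setI0 XY) cards0 addn0; apply: subset_leq_card.
  by apply/subsetP => u; rewrite !inE => /orP [] /andP [].
have Cr : (#|C| <= r)%N by rewrite -[X in (_ <= X)%N]card_ord max_card.
have lower := card_class_cut H.
have upper := sparse_cut XY.
have t0' : 0 < t%:R :> R by rewrite ltr0n.
have lower' : #|C|%:R * (r%:R - #|C|%:R) * t%:R <=
    (\sum_(u in X) #|nbrs adj Y u|)%:R :> R.
  by rewrite -natrB // -!natrM ler_nat.
have cXY' : (#|X| + #|Y|)%:R <= (1 + b) * y * t%:R :> R.
  by rewrite -r_eq -natrM ler_nat.
rewrite r_eq in lower'.
set c := #|C|%:R in lower' *; set E := (\sum_(u in X) _)%:R in lower' upper.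
have key : 4 * (1 + b) * (c * ((1 + b) * y - c) * t%:R) <=
           b * (2 + b) * y * ((1 + b) * y * t%:R).
  have h1 : 4 * (1 + b) * (c * ((1 + b) * y - c) * t%:R) <= 4 * (1 + b) * E.
    by apply: ler_wpM2l lower'; lra.
  apply: le_trans h1 (le_trans upper _).
  by apply: ler_wpM2l cXY'; rewrite !mulr_ge0 //; lra.
have key2 : 4 * (c * ((1 + b) * y - c)) <= b * (2 + b) * y * y.
  have p0 : 0 < (1 + b) * t%:R by rewrite mulr_gt0 //; lra.
  rewrite -(ler_pM2r p0); lra.
case: (lerP c (b / 2 * y)) => h1; first by left.
case: (lerP ((1 + b / 2) * y) c) => h2; first by right.
have := mulr_gt0 (x := c - b / 2 * y) (y := (1 + b / 2) * y - c).
rewrite !subr_gt0 => /(_ h1 h2); nra.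
Qed.

(** Among the classes [D] reachable from [D0], let [H] be those that reach few classes. Take [j] in
    [D] outside [H] with the fewest reachable classes and put [C = Rch j :\: H]: by minimality each
    member of [C] reaches all of [Rch j]. *)
Lemma strong_core V f t (D0 : {set 'I_r}) :
  (0 < t)%N -> balanced V f t -> b * (1 + b) * y <= #|D0|%:R ->
  (forall i, i \in D0 -> i \notin reaching adj V f t) ->
  exists C : {set 'I_r},
    [/\ (1 + b / 2) * y <= #|C|%:R,
        {in C &, forall i j, connect (arrow adj V f) i j},
        forall i, i \in C -> i \notin reaching adj V f t &
        forall i, i \in C -> exists2 j, j \in D0 & connect (arrow adj V f) j i].
Proof.
have [[b0 b1] y0] := (b_gt0, b_lt1, y_gt0).
move=> t0 bal D0big D0A.
have szt j : (#|colour_class V f j| <= t)%N by case/andP: (bal j).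
pose e := connect (arrow adj V f).
pose D := [set i | [exists j in D0, e j i]].
pose Rch i := [set l | e i l].
have DA i : i \in D -> i \notin reaching adj V f t.
  rewrite inE => /exists_inP [j jD ji]; apply: contraNN (D0A j jD).
  exact: reaching_connect ji.
have Dt i : i \in D -> #|colour_class V f i| = t.
  move=> /DA iA; apply/eqP; rewrite eqn_leq szt /= leqNgt; apply: contraNN iA => si.
  by apply/reachingP; exists i; rewrite ?inE.
have Dcl i l : i \in D -> e i l -> l \in D.
  rewrite !inE => /exists_inP [j jD ji] il; apply/exists_inP; exists j => //.
  exact: connect_trans ji il.
have closed (C : {set 'I_r}) : C \subset D ->
    (forall i l, i \in C -> arrow adj V f i l -> l \in C) ->
    #|C|%:R <= b / 2 * y \/ (1 + b / 2) * y <= #|C|%:R.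
  move=> /subsetP CD Ccl; apply: (cut_dichotomy t0 szt) => i l iC lC.
  rewrite -{1}(Dt i (CD i iC)); apply: no_arrow_edges.
  by apply: contraNN lC; apply: Ccl.
pose H := [set i in D | #|Rch i|%:R <= b / 2 * y].
have Hcl i l : i \in H -> arrow adj V f i l -> l \in H.
  rewrite inE => /andP [iD iH] /connect1 il; rewrite inE (Dcl i) //=.
  apply: le_trans iH; rewrite ler_nat subset_leq_card //.
  by apply/subsetP => k; rewrite !inE; apply: connect_trans.
have Hsmall : #|H|%:R <= b / 2 * y.
  case: (closed H) => //; first by apply/subsetP => i; rewrite inE => /andP [].
  (* A vertex coloured in [H] has a neighbour in every class not reached, hence degree at least
     [r - b y / 2 = (1 + b / 2) y]. With [H] large, the degree sum would force
     [(1 + b / 2)^2 <= (1 - b) (1 + b)^2], which fails for [b > 0]. *)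
  move=> Hbig; exfalso.
  pose X := [set u in V | f u \in H].
  have XV : X \subset V by apply/subsetP => u; rewrite inE => /andP [].
  have cX : #|X| = (#|H| * t)%N.
    by apply: card_full_classes => i; rewrite inE => /andP [/Dt].
  have degX u : u \in X -> (1 + b / 2) * y <= #|nbrs adj V u|%:R.
    rewrite !inE => /andP [uV /andP [_ fuH]].
    have : (r <= #|Rch (f u)| + #|nbrs adj V u|)%N.
      rewrite -[X in (X <= _)%N]card_ord -(cardsC (Rch (f u))) leq_add2l.
      apply: leq_trans (card_not_free adj V f u); apply: subset_leq_card.
      apply/subsetP => k; rewrite !inE; apply: contraNN => fr.
      by apply/connect1/arrowP; exists u.
    rewrite -(ler_nat R) natrD r_eq; lra.
  have sumX : #|X|%:R * ((1 + b / 2) * y) <= (\sum_(u in V) #|nbrs adj V u|)%:R.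
    apply: (@le_trans _ _ (\sum_(u in X) #|nbrs adj V u|)%:R).
      rewrite natr_sum mulr_natl -sumr_const; apply: ler_sum => u uX; exact: degX.
    rewrite ler_nat [X in (_ <= X)%N](big_setID X) /= (setIidPr XV).
    exact: leq_addr.
  have upper := le_trans sumX (sparse V).
  have cV : #|V|%:R <= (1 + b) * y * t%:R :> R.
    by rewrite -r_eq -natrM ler_nat (card_balanced szt).
  have t0' : 0 < t%:R :> R by rewrite ltr0n.
  have h1 : (1 + b / 2) * y * t%:R <= #|X|%:R by rewrite cX natrM ler_pM2r.
  have h2 : (1 + b / 2) * y * t%:R * ((1 + b / 2) * y) <= #|X|%:R * ((1 + b / 2) * y).
    by apply: ler_wpM2r h1; rewrite mulr_ge0 //; lra.
  have h3 : (1 - b) * (1 + b) * y * #|V|%:R <= (1 - b) * (1 + b) * y * ((1 + b) * y * t%:R).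
    by apply: ler_wpM2l cV; rewrite !mulr_ge0 //; lra.
  have h4 := le_trans h2 (le_trans upper h3).
  have p0 : 0 < y * y * t%:R by rewrite !mulr_gt0.
  have h5 : (1 + b / 2) * (1 + b / 2) <= (1 - b) * (1 + b) * (1 + b).
    rewrite -(ler_pM2r p0); lra.
  have : 0 < b * b by rewrite mulr_gt0.
  have : 0 < b * b * b by rewrite !mulr_gt0.
  nra.
have [j0 j0D j0H] : exists2 j, j \in D & j \notin H.
  have [j jD0 jH] : exists2 j, j \in D0 & j \notin H.
    apply/subsetPn; apply/negP => /subset_leq_card; rewrite -(ler_nat R).
    by move=> /(le_trans D0big) /le_trans /(_ Hsmall); nra.
  by exists j => //; rewrite inE; apply/exists_inP; exists j => //; apply: connect0.
pose Q j := (j \in D) && (j \notin H).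
have Qj0 : Q j0 by rewrite /Q j0D j0H.
case: (arg_minnP (fun j => #|Rch j|) Qj0) => j /andP [jD jH] minj.
have RD : Rch j \subset D by apply/subsetP => l; rewrite inE; apply: Dcl.
have Rbig : (1 + b / 2) * y <= #|Rch j|%:R.
  case: (closed (Rch j)) => //.
    move=> i l; rewrite !inE => ji il; exact: connect_trans ji (connect1 il).
  by move=> h; case/negP: jH; rewrite inE jD h.
pose C := Rch j :\: H.
have CD i : i \in C -> i \in D by rewrite inE => /andP [_ /(subsetP RD)].
have Cstrong i : i \in C -> Rch i = Rch j.
  move=> iC; have iD := CD i iC; move: iC; rewrite in_setD => /andP [iH]; rewrite inE => ji.
  apply/eqP; rewrite eqEcard; apply/andP; split; last by apply: minj; rewrite /Q iD.
  by apply/subsetP => l; rewrite !inE; apply: connect_trans.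
exists C; split.
- have Cy : y <= #|C|%:R.
    have : (#|Rch j| <= #|C| + #|H|)%N.
      rewrite -(cardsID H (Rch j)) addnC leq_add2l subset_leq_card //.
      by apply/subsetP => i; rewrite inE => /andP [].
    by rewrite -(ler_nat R) natrD; move: Rbig Hsmall; lra.
  case: (@cut_dichotomy V f t C t0 szt) => //; last by move=> h; exfalso; nra.
  move=> i l iC lC; have iD := CD i iC.
  case: (boolP (l \in Rch j)) => lR; last first.
    rewrite -{1}(Dt i iD); apply: no_arrow_edges; apply: contraNN lR => il.
    by rewrite -(Cstrong i iC) inE; apply: connect1.
  (* Here an arrow from [i] to [l] may exist, but none goes from [l] to [i], because [H] is closed
     under arrows. The cut edges are counted from the side of [l]. *)
  have lH : l \in H by move: lC; rewrite inE lR andbT negbK.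
  rewrite sum_nbrsC // -{1}(Dt l (subsetP RD l lR)); apply: no_arrow_edges.
  by move: iC; rewrite inE => /andP [iH _]; apply: contraNN iH; apply: Hcl.
- move=> i l iC; rewrite inE => /andP [_].
  by rewrite -(Cstrong i iC) inE.
- by move=> i /CD/DA.
- by move=> i /CD; rewrite inE => /exists_inP.
Qed.

(** With [q = #|S|], [p = #|P|] and [d = q - p], the size bounds give [q >= y] and [d <= b y]. The
    degree sum is at least [q (q + 1) - d^2 + d], so sparsity yields [(q + 1) (q - (1 - b^2) y) <=
    d^2 - d <= b^2 y^2], while the left side is at least [(y + 1) b^2 y]. *)
Lemma joined_contradiction w (S P : {set T}) (s : nat) :
  P \subset S -> (forall z, z \in S -> adj w z) ->
  (forall z z', z \in P -> z' \in S -> z' != z -> adj z z') ->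
  (1 + b / 2) * y <= s%:R ->
  (2 * s <= #|S| + r)%N -> (#|S| + 2 * s <= #|P| + 2 * r)%N -> False.
Proof.
have [[b0 b1] y0] := (b_gt0, b_lt1, y_gt0).
move=> PS wS PSadj sbig Sbig Pbig.
have wNS : w \notin S by apply/negP => /wS; rewrite adj_irr.
have lower := joined_degree_sum adj_sym adj_irr PS wS PSadj.
have upper := sparse (w |: S).
have pS : (#|P| <= #|S|)%N by apply: subset_leq_card.
rewrite cardsU1 wNS /= in upper.
move: lower; rewrite -(ler_nat R) => /le_trans /(_ upper).
move: Sbig Pbig; rewrite -!(ler_nat R) !natrD !natrM r_eq natrB // -natr1.
have pS' : #|P|%:R <= #|S|%:R :> R by rewrite ler_nat.
have p0 : 0 <= #|P|%:R :> R by rewrite ler0n.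
move: (#|P|%:R : R) (#|S|%:R : R) pS' p0 => p q pq p0 Sbig Pbig main.
have qy : y <= q by nra.
have dby : q - p <= b * y by nra.
have d0 : 0 <= q - p by lra.
have h1 : (q - p) * (q - p) <= b * y * (b * y) by apply: ler_pM.
have h2 : (y + 1) * (b * b * y) <= (q + 1) * (q - (1 - b * b) * y).
  by apply: ler_pM; nra.
have h3 : 0 < b * b * y by rewrite !mulr_gt0.
nra.
Qed.

(** * Insertion of one vertex and construction of the colouring *)

Lemma insert_or_enlarge V f x t :
  x \notin V -> proper_on adj V f -> balanced V f t -> small V f t != set0 ->
  #|nbrs adj V x|%:R <= (1 - b) * (1 + b) * y ->
  extends_balanced adj r V x t \/
  exists g, [/\ proper_on adj V g,
    forall l, #|colour_class V g l| = #|colour_class V f l| &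
    (#|reaching adj V f t| < #|reaching adj V g t|)%N].
Proof.
have [[b0 b1] y0] := (b_gt0, b_lt1, y_gt0).
move=> xV prf bal /set0Pn [k0 k0s] degx.
have t0 : (0 < t)%N by move: k0s; rewrite inE; apply: leq_trans.
have szt j : (#|colour_class V f j| <= t)%N by case/andP: (bal j).
set A := reaching adj V f t.
pose D0 := [set j | free_for adj V f x j].
case: (boolP [exists j in D0, j \in A]) => [/exists_inP [j] | /exists_inPn D0A].
  by rewrite inE => fr jA; left; apply: (insert_reaching adj_sym adj_irr xV prf bal fr jA).
have D0big : b * (1 + b) * y <= #|D0|%:R.
  have : (r <= #|D0| + #|nbrs adj V x|)%N.
    rewrite -[X in (X <= _)%N]card_ord -(cardsC D0) leq_add2l.
    apply: leq_trans (card_not_free adj V f x); apply: subset_leq_card.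
    by apply/subsetP => k; rewrite !inE.
  rewrite -(ler_nat R) natrD r_eq; lra.
have [C [Cbig Cstrong CA CD0]] := strong_core t0 bal D0big D0A.
have [W [/reachingP WA termW]] := terminal_vertex (arrow adj V f) k0s.
have {}termW : terminal adj V f t W by move=> i iW /reachingP; apply: termW.
have Cr : (#|C| <= r)%N by rewrite -[X in (_ <= X)%N]card_ord max_card.
have Chalf : (r < 2 * #|C|)%N by rewrite -(ltr_nat R) r_eq natrM; nra.
have C0 : (0 < #|C|)%N by case: #|C| Chalf; rewrite ?muln0.
have Ct i : i \in C -> #|colour_class V f i| = t.
  move=> /CA iA; apply/eqP; rewrite eqn_leq szt /= leqNgt; apply: contraNN iA => si.
  by apply/reachingP; exists i; rewrite ?inE.
pose S := [set z in V | f z \in C].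
have nbW z : z \in S -> exists w, [/\ w \in V, f w = W & adj z w].
  by rewrite inE => /andP [zV /CA zA]; apply: not_reaching_adj zA WA.
have [w [wV fw wt]] := many_solo_neighbours adj_sym t0 C0 (szt W) Ct nbW.
pose Sw := [set z in S | solo adj V f w z].
pose Nw := [set z in S | adj w z & ~~ solo adj V f w z].
have SwP z : z \in Sw -> [/\ z \in V, f z \in C & solo adj V f w z].
  by rewrite !inE => /andP [/andP []].
have wSw z : z \in Sw -> adj w z by case/SwP => _ _ /soloP [zw _]; rewrite adj_sym.
have wdeg : (#|Sw| + #|Nw| <= r)%N.
  apply: leq_trans (degree_le V w); rewrite -cardsUI.
  have -> : Sw :&: Nw = set0.
    by apply/setP => z; rewrite !inE; case: solo; rewrite ?andbF.
  rewrite cards0 addn0; apply: subset_leq_card; apply/subsetP => z.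
  rewrite inE => /orP [zS | ]; first by have [zV _ _] := SwP z zS; rewrite inE zV wSw.
  by rewrite !inE => /andP [/andP [-> _] /andP [-> _]].
have {}wt : (2 * #|C| <= 2 * #|Sw| + #|Nw|)%N := wt.
have Swbig : (2 * #|C| <= #|Sw| + r)%N.
  by apply: leq_trans wt _; rewrite mul2n -addnn -addnA leq_add2l.
have [z0 z0S] : exists z, z \in Sw.
  apply/set0Pn; rewrite -card_gt0 lt0n; apply: contraTneq Chalf => S0.
  by move: Swbig; rewrite S0 -leqNgt.
rewrite -fw in WA termW.
case: (boolP [exists K in A, (K != f w) && free_for adj V f w K]).
  case/exists_inP => K KA /andP [Kw wK]; left.
  have [p [pp up lp wp]] := termW K Kw KA.
  have [z0V z0C z0solo] := SwP z0 z0S.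
  have [j jD0 jz] := CD0 _ z0C.
  have jA := D0A j jD0; rewrite inE in jD0.
  exact: (insert_movable adj_sym adj_irr xV prf bal jD0 jz jA wV z0V WA z0solo wK pp up lp wp).
move=> /exists_inPn movN.
have imm : immovable adj V f t w.
  by move=> K KA Kw; have := movN K KA; rewrite Kw.
right; case: (boolP [exists U in C, free_for adj V f w U]).
  case/exists_inP => U UC wU.
  case: (boolP [exists z in Sw, exists z' in Sw, (z' != z) && ~~ adj z' z]).
    case/exists_inP => z zS /exists_inP [z' zS' /andP [zz nzz]].
    have [zV zC zsolo] := SwP z zS; have [zV' zC' zsolo'] := SwP z' zS'.
    exact: (detour_enlarges adj_sym adj_irr prf wV zV zV' WA termW imm
      (CA U UC) wU (Cstrong _ _ UC zC) (Cstrong _ _ UC zC') zsolo zsolo' zz nzz).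
  move=> /exists_inPn clique; exfalso.
  (* All solo neighbours are pairwise adjacent, so [P] is the whole of [Sw] and its size condition
     reduces to [#|C| <= r]. *)
  apply: (@joined_contradiction w Sw Sw #|C|) => //.
    move=> z z' zS zS' zz; have /exists_inPn /(_ z' zS') := clique z zS.
    by rewrite zz negbK adj_sym.
  by rewrite leq_add2l leq_mul2l Cr orbT.
move=> /exists_inPn hit.
pose P := [set z in S | solo adj V f w z &
             [forall u in V, ((f u == f z) && adj w u) ==> (u == z)]].
have wP : (2 * #|C| <= #|Sw| + 2 * #|Nw| + #|P|)%N := many_single_solo hit.
have PS : P \subset Sw.
  by apply/subsetP => z; rewrite !inE => /andP [-> /andP [-> _]].
case: (boolP [exists z in P, exists z' in Sw, (z' != z) && ~~ adj z' z]).
  case/exists_inP => z zP /exists_inP [z' zS' /andP [zz nzz]].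
  have [zV zC zsolo] := SwP z (subsetP PS z zP).
  have [zV' zC' zsolo'] := SwP z' zS'.
  have single u : u \in V -> f u = f z -> adj w u -> u = z.
    move=> uV fu wu; move: zP; rewrite !inE => /and3P [_ _ /forall_inP /(_ u uV)].
    by rewrite fu eqxx wu => /eqP.
  exact: (swap_enlarges adj_sym adj_irr prf wV zV zV' WA termW imm
    (CA _ zC) (CA _ zC') zsolo zsolo' zz nzz single).
move=> /exists_inPn clique; exfalso.
apply: (@joined_contradiction w Sw P #|C|) => //.
  move=> z z' zS zS' zz; have /exists_inPn /(_ z' zS') := clique z zS.
  by rewrite zz negbK adj_sym.
(* Adding [#|Sw|] to [wP] and bounding [2 * (#|Sw| + #|Nw|)] by [2 * r] gives the required lower
   bound on [#|P|]. *)
move: wP wdeg; clear; lia.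
Qed.

(** Enlarging moves keep all class sizes, hence the same [t] and small classes, and the reaching set
    cannot exceed [r] classes. *)
Lemma extend_colouring V f x t :
  x \notin V -> proper_on adj V f -> balanced V f t -> small V f t != set0 ->
  #|nbrs adj V x|%:R <= (1 - b) * (1 + b) * y ->
  extends_balanced adj r V x t.
Proof.
move=> xV + + + degx.
have [n] := ubnP (r - #|reaching adj V f t|); elim: n f => // n IHn f nf prf bal sm.
have [//|[g [prg szg grow]]] := insert_or_enlarge xV prf bal sm degx.
apply: (IHn g) => //.
- have : (#|reaching adj V g t| <= r)%N by rewrite -[X in (_ <= X)%N]card_ord max_card.
  by move: nf grow; clear; lia.
- by move=> l; rewrite szg.
- suff -> : small V g t = small V f t by [].
  by apply/setP => l; rewrite !inE szg.
Qed.

Lemma balanced_colouring V : exists t f, proper_on adj V f /\ balanced V f t.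
Proof.
have [[b0 b1] y0] := (b_gt0, b_lt1, y_gt0).
have r0 : (0 < r)%N by rewrite -(ltr_nat R) r_eq mulr_gt0 //; lra.
have [n] := ubnP #|V|; elim: n V => // n IHn V; rewrite ltnS => Vn.
have [-> | Vn0] := eqVneq V set0.
  exists 0%N, (fun _ => Ordinal r0); split; first by move=> u v; rewrite inE.
  move=> j; suff -> : colour_class set0 (fun _ : T => Ordinal r0) j = set0.
    by rewrite cards0.
  by apply/setP => u; rewrite !inE.
have [x xV degx] : exists2 x, x \in V & #|nbrs adj V x|%:R <= (1 - b) * (1 + b) * y.
  case: (boolP [exists x in V, #|nbrs adj V x|%:R <= (1 - b) * (1 + b) * y]).
    by move/exists_inP.
  move=> /exists_inPn big; exfalso; have := sparse V; rewrite leNgt => /negP; apply.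
  rewrite natr_sum mulr_natr -sumr_const; apply: ltr_sum => [|u uV].
    by case/set0Pn: Vn0 => u uV; apply/hasP; exists u; rewrite ?mem_index_enum.
  by rewrite ltNge; apply: big.
have [|t [f [prf bal]]] := IHn (V :\ x).
  by apply: leq_trans Vn; rewrite [X in (_ < X)%N](cardsD1 x) xV.
have degx' : #|nbrs adj (V :\ x) x|%:R <= (1 - b) * (1 + b) * y.
  apply: le_trans degx; rewrite ler_nat; apply: subset_leq_card.
  by apply/subsetP => u; rewrite !inE => /andP [/andP [_ ->]].
have xNV : x \notin V :\ x by rewrite !inE eqxx.
rewrite -(setD1K xV).
case: (eqVneq (small (V :\ x) f t) set0) => [sm | sm]; last first.
  by have [g [prg balg]] := extend_colouring xNV prf bal sm degx'; exists t, g.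
(* Without small classes every class has exactly [t] vertices; passing to [t.+1] makes all of them
   small. *)
have full l : #|colour_class (V :\ x) f l| = t.
  apply/eqP; rewrite eqn_leq; case/andP: (bal l) => -> _ /=.
  by move/setP/(_ l): sm; rewrite !inE ltnNge => /negbFE.
have bal' : balanced (V :\ x) f t.+1 by move=> l; rewrite full leqnSn leqnn.
have sm' : small (V :\ x) f t.+1 != set0.
  by apply/set0Pn; exists (Ordinal r0); rewrite inE full.
by have [g [prg balg]] := extend_colouring xNV prf bal' sm' degx'; exists t.+1, g.
Qed.

Lemma sparse_equitable_coloring : has_equitable_coloring adj r.
Proof.
have [t [f [prf bal]]] := balanced_colouring setT.
exists f; split; first by move=> u v uv; apply: prf; rewrite ?inE.
have E l : [set u | f u == l] = colour_class setT f l.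
  by apply/setP => u; rewrite !inE.
move=> i j; rewrite !E; case/andP: (bal i) => it _; case/andP: (bal j) => _ jt.
exact: leq_trans it jt.
Qed.

End Density.

(** * Density of graphs in the class *)

(** Double counting of incidences between [X] and [E]: for fixed [u], the map sending [v] to
    [[set u; v]] is injective on neighbours. An edge is counted at most twice when [X = Y], and once
    when it crosses a cut. *)
Lemma sum_nbrs_incidence (T : finType) (adj : rel T) (X Y : {set T})
    (E : {set {set T}}) :
  irreflexive adj ->
  (forall u v, u \in X -> v \in Y -> adj u v -> [set u; v] \in E) ->
  \sum_(u in X) #|nbrs adj Y u| <= \sum_(e in E) #|e :&: X|.
Proof.
move=> adj_irr XYE.
have -> : \sum_(e in E) #|e :&: X| = \sum_(u in X) #|[set e in E | u \in e]|.
  have cE (e : {set T}) : #|e :&: X| = \sum_(u in X) (u \in e).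
    by rewrite -sum1_card big_mkcond [RHS]big_mkcond; apply: eq_bigr => u _;
      rewrite inE andbC; case: (u \in X) => //; case: (u \in e).
  under eq_bigr do rewrite cE; rewrite exchange_big /=; apply: eq_bigr => u _.
  by rewrite -sum1_card big_mkcond [RHS]big_mkcond; apply: eq_bigr => e _;
    rewrite inE; case: (e \in E) => //; case: (u \in e).
apply: leq_sum => u uX.
rewrite -(card_in_imset (f := fun v => [set u; v])); last first.
  move=> v v'; rewrite !inE => /andP [_ uv] /andP [_ uv'] /setP /(_ v).
  rewrite !inE eqxx orbT => /esym /orP [/eqP vu | /eqP //].
  by rewrite vu adj_irr in uv.
apply: subset_leq_card; apply/subsetP => e /imsetP [v].
rewrite inE => /andP [vY uv] ->; rewrite inE XYE //=.
by rewrite !inE eqxx.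
Qed.

Lemma edgesP (T : finType) (adj : rel T) (e : {set T}) :
  reflect (exists x y, adj x y /\ e = [set x; y]) (e \in edges adj).
Proof.
rewrite inE; apply: (iffP existsP) => [[x /existsP [y /andP [xy /eqP ->]]] | [x [y [xy ->]]]].
  by exists x, y.
by exists x; apply/existsP; exists y; rewrite xy eqxx.
Qed.

Section ClassDensity.

Variables (R : realType) (m1 m2 : R) (T : finType) (adj : rel T).
Hypotheses (graph : simple_graph adj) (inC : in_class m1 m2 adj).

Local Open Scope ring_scope.

Lemma class_degree_sum (X : {set T}) :
  (\sum_(u in X) #|nbrs adj X u|)%:R <= 2 * m1 * #|X|%:R.
Proof.
pose E := [set e in edges adj | e \subset X].
have sub : is_subgraph adj X E.
  split; first by apply/subsetP => e; rewrite inE => /andP [].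
  by move=> e; rewrite inE => /andP [].
have [_ adj_irr] := graph.
have : (\sum_(u in X) #|nbrs adj X u| <= 2 * #|E|)%N.
  apply: leq_trans (@sum_nbrs_incidence _ adj X X E adj_irr _) _.
    move=> u v uX vX uv; rewrite inE; apply/andP; split.
      by apply/edgesP; exists u, v.
    by apply/subsetP => z; rewrite !inE => /orP [] /eqP ->.
  rewrite mulnC -sum_nat_const; apply: leq_sum => e.
  rewrite inE => /andP [/edgesP [u [v [_ ->]]] _].
  apply: leq_trans (subset_leq_card (subsetIl _ _)) _.
  by rewrite cards2; case: (u != v).
rewrite -(ler_nat R) natrM => /le_trans; apply.
by rewrite -mulrA ler_pM2l ?ltr0n //; apply: inC.1.
Qed.

Lemma class_cut_sum (X Y : {set T}) : [disjoint X & Y] ->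
  (\sum_(u in X) #|nbrs adj Y u|)%:R <= m2 * (#|X| + #|Y|)%:R.
Proof.
move=> XY.
pose E := [set e in edges adj | (e \subset X :|: Y) && (#|e :&: X| == 1%N)].
have sub : is_subgraph adj (X :|: Y) E.
  split; first by apply/subsetP => e; rewrite inE => /andP [].
  by move=> e; rewrite inE => /and3P [].
have bip : is_bipartite (X :|: Y) E.
  by exists X; split; [exact: subsetUl | move=> e; rewrite inE => /and3P [_ _ /eqP]].
have [_ adj_irr] := graph.
have : (\sum_(u in X) #|nbrs adj Y u| <= #|E|)%N.
  apply: leq_trans (@sum_nbrs_incidence _ adj X Y E adj_irr _) _.
    move=> u v uX vY uv; have vX : v \notin X by rewrite (disjointFl XY vY).
    rewrite inE; apply/and3P; split; first by apply/edgesP; exists u, v.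
      by apply/subsetP => z; rewrite !inE => /orP [] /eqP ->; rewrite ?uX ?vY ?orbT.
    apply/cards1P; exists u; apply/setP => z; rewrite !inE.
    by case: eqVneq => [-> // | _] /=; case: eqVneq => // ->; rewrite (negPf vX).
  by rewrite -sum1_card; apply: leq_sum => e; rewrite inE => /and3P [_ _ /eqP ->].
rewrite -(ler_nat R) => /le_trans; apply.
apply: le_trans (inC.2 _ _ sub bip) _.
by rewrite cardsU (disjoint_setI0 XY) cards0 subn0.
Qed.

End ClassDensity.

(** * The inequality at [beta] and the final assembly *)

Local Open Scope ring_scope.

(* By the intermediate value theorem the maximum is attained with equality. *)
Lemma beta_bound (R : realType) (m1 m2 beta : R) :
  0 < m1 -> 0 < m2 -> is_beta m1 m2 beta ->
  2 * m2 * (1 - beta) * (1 + beta) ^+ 2 <= m1 * beta * (beta + 2).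
Proof.
move=> m10 m20 [[b2 [b1 _]] bmax]; rewrite leNgt; apply/negP => big.
(* The inequality defining [beta_pred], cleared of denominators. If the claim failed, [p] would be
   negative at [beta], and it equals [3 m1 > 0] at 1. A root in between satisfies [beta_pred], so
   maximality makes it equal to [beta], where [p] is not zero. *)
pose p : {poly R} := m1 *: ('X * ('X + 2%:P)) - (2 * m2) *: ((1 - 'X) * (1 + 'X) ^+ 2).
have pE x : p.[x] = m1 * (x * (x + 2)) - (2 * m2) * ((1 - x) * (1 + x) ^+ 2).
  by rewrite /p !hornerE.
have pb : p.[beta] < 0 by rewrite pE; lra.
have p1 : 0 < p.[1] by rewrite pE; lra.
have [x /andP [bx x1] /rootP px] : exists2 x, beta <= x <= 1 & root p x.
  by apply: poly_ivt; [exact: ltW | rewrite (ltW pb) (ltW p1)].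
have x1' : x < 1 by rewrite lt_neqAle x1 andbT; apply: contraTneq p1 => <-; rewrite px ltxx.
have : x <= beta.
  apply: bmax; split; first exact: le_trans b2 bx.
  split => //; have x0 : 0 < x by apply: lt_le_trans bx; lra.
  have xx : 0 < x * (x + 2) by rewrite mulr_gt0 //; lra.
  rewrite ler_pdivlMr // mulrAC ler_pdivrMr //.
  by move: px; rewrite pE; lra.
move=> xb; have xE : x = beta by apply: le_anti; rewrite xb.
by rewrite -xE px ltxx in pb.
Qed.

Theorem theorem4 (R : realType) (m1 m2 : R) (beta : R)
  (T : finType) (adj : rel T) (r : nat) :
  0 < m1 -> 0 < m2 -> m1 <= (9 / 5) * m2 ->
  is_beta m1 m2 beta ->
  simple_graph adj ->
  in_class m1 m2 adj ->
  (2 / (1 - beta)) * m1 <= r%:R ->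
  (max_degree adj <= r)%N ->
  has_equitable_coloring adj r.
Proof.
move=> m10 m20 _ isb graph inC r0 Dr.
have [adj_sym adj_irr] := graph.
have bb := beta_bound m10 m20 isb.
have [[b2 [b1 _]] _] := isb.
have b0 : 0 < beta by lra.
have r1 : 2 * m1 <= (1 - beta) * r%:R.
  move: r0; rewrite mulrAC ler_pdivrMr; last by lra.
  by rewrite [_ * (1 - beta)]mulrC.
have [y y0 ry] : exists2 y, 0 < y & r%:R = (1 + beta) * y.
  exists (r%:R / (1 + beta)); last by rewrite mulrC divfK //; lra.
  rewrite divr_gt0 //; last by lra.
  by rewrite -(pmulr_rgt0 _ (x := 1 - beta)); lra.
rewrite ry in r1.
apply: (sparse_equitable_coloring adj_sym adj_irr b0 b1 y0 ry).
- move=> X; apply: le_trans (class_degree_sum graph inC X) _.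
  by rewrite ler_wpM2r ?ler0n // -mulrA.
- move=> X Y XY; have := class_cut_sum graph inC XY.
  set E := (\sum_(u in X) _)%:R; set N := (_ + _)%:R => EN.
  (* Twice the inequality at [beta], with [2 m1] replaced by its bound [(1 - beta) (1 + beta) y];
     then [(1 - beta) (1 + beta)] cancels. *)
  have key : 4 * (1 + beta) * m2 <= beta * (2 + beta) * y.
    have p0 : 0 < (1 - beta) * (1 + beta) by rewrite mulr_gt0 //; lra.
    rewrite -(ler_pM2r p0).
    have : m1 * 2 * (beta * (beta + 2)) <= (1 - beta) * ((1 + beta) * y) * (beta * (beta + 2)).
      by apply: ler_wpM2r; [rewrite mulr_ge0 //; lra | lra].
    by move: bb; lra.
  have h1 : 4 * (1 + beta) * E <= 4 * (1 + beta) * (m2 * N).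
    by apply: ler_wpM2l EN; lra.
  apply: le_trans h1 _; rewrite mulrA.
  by apply: ler_wpM2r key; rewrite ler0n.
- move=> X u; apply: leq_trans Dr; apply: leq_trans (leq_bigmax u).
  by apply: subset_leq_card; apply/subsetP => v; rewrite !inE => /andP [].
Qed.
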